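(* Let $p\in(1,2)$. Assume that, for some constants $A_1(p)$ and $A_2(p)$, $$\|G_{X_1}(X_1)\|_{w,p}^p\le A_1(p)\quad\text{and}\quad\|G_\varepsilon(\varepsilon)\|_{w,p}^p\le A_2(p).$$ Then, for any $x>0$, $$\mathbb P(|S_n|>x)\le\frac{C_p\,B(n,\rho,p)}{x^p},$$ where $$C_p=\frac{4p}{p-1}+\frac{8p}{2-p}\quad\text{and}\quad B(n,\rho,p)=A_1(p)(K_{n-1}(\rho))^p+A_2(p)\sum_{k=2}^n(K_{n-k}(\rho))^p.$$
   Context: $(\mathcal X,d)$ and $(\mathcal Y,\delta)$ are complete separable metric spaces; $(\varepsilon_i)_{i\ge1}$ is a sequence of iid $\mathcal Y$-valued random variables; $X_1$ is an $\mathcal X$-valued random variable independent of $(\varepsilon_i)_{i\ge2}$. The Markov chain is $X_n=F(X_{n-1},\varepsilon_n)$ for $n\ge2$, where $F:\mathcal X\times\mathcal Y\to\mathcal X$ is measurable and satisfies, for some $\rho\in[0,1)$ and $C>0$, $\mathbb E[d(F(x,\varepsilon_1),F(x',\varepsilon_1))]\le\rho\,d(x,x')$ for all $x,x'\in\mathcal X$, and $d(F(x,y),F(x,y'))\le C\,\delta(y,y')$ for all $x\in\mathcal X$, $y,y'\in\mathcal Y$. Fix $n\ge1$ and $f:\mathcal X^n\to\mathbb R$ with $|f(x_1,\ldots,x_n)-f(x_1',\ldots,x_n')|\le d(x_1,x_1')+\cdots+d(x_n,x_n')$, and let $S_n=f(X_1,\ldots,X_n)-\mathbb E[f(X_1,\ldots,X_n)]$.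 Let $P_{X_1}$ be the law of $X_1$, $P_\varepsilon$ the common law of the $\varepsilon_k$'s, $G_{X_1}(x)=\int d(x,x')P_{X_1}(dx')$, $G_\varepsilon(y)=\int C\,\delta(y,y')P_\varepsilon(dy')$; $G_\varepsilon(\varepsilon)$ denotes a random variable distributed as $G_\varepsilon(\varepsilon_k)$. For $k\in\mathbb N$, $K_k(\rho)=1+\rho+\cdots+\rho^k$. For a real random variable $Z$ and $p\ge1$, the weak moment is $\|Z\|_{w,p}^p=\sup_{x>0}x^p\,\mathbb P(|Z|>x)$. *)

(* Defs.v *)
From HB Require Import structures.
From mathcomp Require Import all_boot all_order all_algebra finmap.
From mathcomp Require Import all_classical all_reals all_analysis.

Set Implicit Arguments.
Unset Strict Implicit.
Unset Printing Implicit Defensive.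

Import Order.TTheory GRing.Theory Num.Theory.
Import numFieldNormedType.Exports.

Local Open Scope classical_set_scope.
Local Open Scope ring_scope.

(* The base point required by the library's [Complete] excludes only the empty
   space, which carries no random variable. *)
#[short(type="completeMetricType")]
HB.structure Definition CompleteMetric (R : numDomainType) :=
  { M of Metric R M & Complete M }.

Definition separable (M : topologicalType) : Prop :=
  exists2 D : set M, countable D & dense D.

Notation borel M := (g_sigma_algebraType (@open M)).

Section independence.
Context {d dX dY : measure_display} {T : measurableType d}
  {X : measurableType dX} {Y : measurableType dY} {R : realType}
  (P : probability T R).

Definition mutually_independent (I : choiceType) (D : set I)
    (Z : I -> {RV P >-> Y}) : Prop :=
  forall (J : {fset I}) (A : I -> set Y),
    [set` J] `<=` D -> (forall i, i \in J -> measurable (A i)) ->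
    P (\bigcap_(i in [set` J]) (Z i @^-1` A i)) =
      (\prod_(i <- J) P (Z i @^-1` A i))%E.

Definition identically_distributed (I : Type) (D : set I)
    (Z : I -> {RV P >-> Y}) : Prop :=
  forall i j, D i -> D j -> forall A : set Y, measurable A ->
    distribution P (Z i) A = distribution P (Z j) A.

Definition sigma_generated (I : Type) (D : set I) (Z : I -> {RV P >-> Y}) :
    set (set T) :=
  <<s \bigcup_(i in D) preimage_set_system setT (Z i) measurable >>.

Definition independent_of_family (U : {RV P >-> X}) (I : Type) (D : set I)
    (Z : I -> {RV P >-> Y}) : Prop :=
  forall (A : set X) (B : set T), measurable A -> sigma_generated D Z B ->
    P (U @^-1` A `&` B) = (P (U @^-1` A) * P B)%E.

End independence.

(* [weak_moment P p Z] is the p-th power of the weak norm of Z. It accepts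
   extended-real Z because the functions G below may take the value +oo. *)
Definition weak_moment {d : measure_display} {T : measurableType d}
    {R : realType} (P : probability T R) (p : R) (Z : T -> \bar R) : \bar R :=
  ereal_sup [set ((x `^ p)%:E * P [set w | x%:E < `|Z w|])%E
            | x in [set x : R | 0 < x]].

Definition G_init {d : measure_display} {T : measurableType d} {R : realType}
    (P : probability T R) (M : completeMetricType R)
    (X1 : {RV P >-> borel M}) (x : M) : \bar R :=
  (\int[distribution P X1]_x' (@mdist R M x x')%:E)%E.

Definition G_noise {d : measure_display} {T : measurableType d} {R : realType}
    (P : probability T R) (N : completeMetricType R) (C : R)
    (e : {RV P >-> borel N}) (y : N) : \bar R :=
  (\int[distribution P e]_y' (C * @mdist R N y y')%:E)%E.

Definition centered {d : measure_display} {T : measurableType d} {R : realType}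
    (P : probability T R) (Z : T -> R) (w : T) : R :=
  Z w - fine ('E_P[Z])%E.

Definition K {R : realType} (rho : R) (k : nat) : R :=
  \sum_(0 <= i < k.+1) rho ^+ i.

Definition Cp {R : realType} (p : R) : R :=
  4 * p / (p - 1) + 8 * p / (2 - p).

Definition B {R : realType} (A1 A2 : R) (n : nat) (rho p : R) : R :=
  A1 * (K rho n.-1) `^ p + A2 * \sum_(2 <= k < n.+1) (K rho (n - k)) `^ p.

(* Main.v *)
Require Import Defs.
From HB Require Import structures.
From mathcomp Require Import all_boot all_order all_algebra finmap.
From mathcomp Require Import all_classical all_reals all_analysis.
From mathcomp Require Import measurable_realfun ring lra.

Set Implicit Arguments.
Unset Strict Implicit.
Unset Printing Implicit Defensive.

Import Order.TTheory GRing.Theory Num.Theory.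
Import numFieldNormedType.Exports.

Local Open Scope classical_set_scope.
Local Open Scope ring_scope.

(** The chain is a function of the independent variables [X 1, eps 2, ..., eps n],
    so the functional minus its mean is a sum of martingale increments, obtained
    by integrating out the noises one at a time, from the last to the first.
    Integrating out [eps k] keeps the functional Lipschitz, with constant
    [K rho (n - k)] before and [1 + rho * K rho (n - k) = K rho (n - k).+1] after
    integration in its last coordinate ([lip_last_average]). Hence the [k]-th
    increment is dominated by [K rho (n - k)] times [G_noise] of [eps k], and the
    first one by [K rho n.-1] times [G_init] of [X 1] ([lipschitz_deviation]):
    these have finite weak moments of order [p].

    The weak-type inequality for such a sum is usually proved by truncating the
    increments and recentering both parts. Here both parts are handled at once by
    the Huber function [huber x], which is quadratic between [- x] and [x] and
    linear outside. Since it is at least [x ^+ 2] there, Markov's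
    inequality reduces the claim to a bound on its expectation ([huber_markov]).
    Its first-order expansion ([huber_add]) has a linear term with a bounded
    coefficient depending on the past, whose expectation vanishes because the next
    noise is independent of the past ([history_indep_eps], [indep_integral_eq0]),
    and a remainder which is quadratic for small increments and linear for large
    ones. For [1 < p < 2] the expectation of this remainder is bounded by the weak
    moment, up to the factor [Cp p * x `^ (2 - p)] ([weak_tail_huber_rem]). Summing
    over the steps ([chain_huber_bound]) and dividing by [x ^+ 2] gives the
    result.

    Measurability needs care, as the functional is only Lipschitz for the sum of
    the distances while independence speaks of products of Borel sigma-algebras;
    [measurable_lipschitz] bridges the two in separable spaces. *)

(** * The Huber function *)

Section huber.
Context {R : realType}.
Implicit Types x s u v : R.

Definition clamp x s := Num.max (- x) (Num.min x s).

(** The Huber function at level [x]: [s ^+ 2] for [`|s| <= x], continued by its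
    tangents. It is the supremum of [2 * l * s - l ^+ 2] over [`|l| <= x],
    attained at [l = clamp x s], and its derivative is [2 * clamp x s]. *)
Definition huber x s := 2 * clamp x s * s - clamp x s ^+ 2.

(** Twice [u ^+ 2] for [`|u| <= 2 * x], linear beyond: the error term of the
    first-order expansion of [huber x] over an increment [u]. *)
Definition huber_rem x u := 2 * `|u| * Num.min `|u| (2 * x).

Lemma clamp_cases x s : 0 < x ->
  [\/ s <= - x /\ clamp x s = - x, - x <= s <= x /\ clamp x s = s |
      x <= s /\ clamp x s = x].
Proof.
move=> x0; have xx : - x <= x by lra.
case: (leP s (- x)) => sx.
  by constructor 1; split => //; rewrite /clamp (min_idPr _) ?(max_idPl _)//; lra.
case: (leP s x) => sx'.
  by constructor 2; split; [lra|rewrite /clamp (min_idPr _) ?(max_idPr _)//; lra].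
by constructor 3; split; [lra|rewrite /clamp (min_idPl _) ?(max_idPr _)//; lra].
Qed.

Lemma clamp_norm_le x s : 0 < x -> `|clamp x s| <= x.
Proof.
move=> x0; rewrite ler_norml.
by case: (clamp_cases s x0) => -[? ->]; lra.
Qed.

Lemma huber_ge0 x s : 0 < x -> 0 <= huber x s.
Proof. by move=> x0; rewrite /huber; case: (clamp_cases s x0) => -[? ->]; nra. Qed.

Lemma huber_ge x s : 0 < x -> x <= `|s| -> x ^+ 2 <= huber x s.
Proof.
move=> x0; rewrite /huber ler_normr => /orP xs.
by case: (clamp_cases s x0) => -[? ->]; case: xs => ?; nra.
Qed.

Lemma huber0 x : 0 < x -> huber x 0 = 0.
Proof. by move=> x0; rewrite /huber; case: (clamp_cases 0 x0) => -[? ->]; nra. Qed.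

Lemma huber_le_norm x s : 0 < x -> huber x s <= 2 * x * `|s|.
Proof.
move=> x0; rewrite /huber; have := ler_norm s; have := ler_norm (- s).
by rewrite normrN; case: (clamp_cases s x0) => -[? ->]; nra.
Qed.

(** First-order expansion with an explicit remainder. By the dual formula with
    the optimal [l] at [s + u] tested at [s], the remainder is at most
    [2 * (clamp x (s + u) - clamp x s) * u], and [clamp x] is 1-Lipschitz with
    values in an interval of length [2 * x]. *)
Lemma huber_add x s u : 0 < x ->
  huber x (s + u) <= huber x s + 2 * clamp x s * u + huber_rem x u.
Proof.
move=> x0.
have dual : 2 * clamp x (s + u) * s - clamp x (s + u) ^+ 2 <= huber x s.
  rewrite /huber; have := clamp_norm_le (s + u) x0; rewrite ler_norml.
  move: (clamp x (s + u)) => l /andP[l1 l2].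
  case: (clamp_cases s x0) => -[sx ->].
  - have : 0 <= (l + x) * (l - x - 2 * s) by apply: mulr_ge0; lra.
    lra.
  - by have := sqr_ge0 (l - s); lra.
  - have : 0 <= (x - l) * (2 * s - l - x) by apply: mulr_ge0; lra.
    lra.
suff : 2 * (clamp x (s + u) - clamp x s) * u <= huber_rem x u.
  by move: dual; rewrite [huber x (s + u)]/huber; lra.
have lip : `|clamp x (s + u) - clamp x s| <= Num.min `|u| (2 * x).
  have := ler_norm u; have := ler_norm (- u); rewrite normrN => u1 u2.
  rewrite le_min; apply/andP; split; rewrite ler_norml;
  by case: (clamp_cases s x0) => -[? ->];
     case: (clamp_cases (s + u) x0) => -[? ->]; lra.
rewrite /huber_rem -!mulrA ler_pM2l// (le_trans (ler_norm _))// normrM mulrC.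
by rewrite ler_wpM2l.
Qed.

Lemma le_huber_rem x u v : 0 < x -> `|u| <= v -> huber_rem x u <= huber_rem x v.
Proof.
move=> x0 uv; rewrite /huber_rem -!mulrA ler_pM2l//.
have -> : `|v| = v by rewrite ger0_norm// (le_trans _ uv).
rewrite ler_pM// ?le_min ?normr_ge0 ?mulr_ge0 ?(ltW x0)//=.
by rewrite !ge_min uv lexx orbT.
Qed.

Lemma huber_rem_ge0 x u : 0 < x -> 0 <= huber_rem x u.
Proof. by move=> x0; rewrite !mulr_ge0// le_min normr_ge0 mulr_ge0// ltW. Qed.

(** Splits the remainder into the two pieces that a weak moment of order
    between 1 and 2 controls: a truncated square and an excess. *)
Lemma huber_remE x u : 0 < x -> 0 <= u ->
  huber_rem x u = 2 * Num.min u (2 * x) ^+ 2 + 4 * x * Num.max (u - 2 * x) 0.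
Proof.
move=> x0 u0; rewrite /huber_rem ger0_norm//.
case: (leP u (2 * x)) => ux; first by rewrite (max_idPr _) ?subr_le0//; ring.
by rewrite (max_idPl _) ?subr_ge0 ?(ltW ux)//; ring.
Qed.

Lemma measurable_clamp x : measurable_fun setT (clamp x).
Proof. by apply: measurable_maxr => //; exact: measurable_minr. Qed.

Lemma measurable_huber x : measurable_fun setT (huber x).
Proof.
apply: measurable_funB; last by apply: measurable_funX; exact: measurable_clamp.
by apply: measurable_funM => //; apply: measurable_funM => //; exact: measurable_clamp.
Qed.

Lemma measurable_huber_rem x : measurable_fun setT (huber_rem x).
Proof.
apply: measurable_funM; first exact: measurable_funM.
exact: measurable_minr.
Qed.

End huber.

(** * Moments of a variable with a polynomial tail *)

Section weak_tail.
Context d (T : measurableType d) {R : realType} (P : probability T R).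
Implicit Types D : T -> R.
Local Notation mu := (@lebesgue_measure R).

Lemma ge0_integral_ccdf D : measurable_fun setT D -> (forall w, 0 <= D w) ->
  (\int[P]_w (D w)%:E = \int[mu]_(r in `[0%R, +oo[) P [set w | (r < D w)%R])%E.
Proof.
move=> mD D0.
pose mixin := isMeasurableFun.Build _ _ _ _ _ mD.
pose D' : {RV P >-> R} := HB.pack D mixin.
have := @ge0_expectation_ccdf _ _ _ P D' D0; rewrite unlock => ->.
apply: eq_integral => r _; rewrite /ccdf /distribution /pushforward/=.
by congr (P _); apply/seteqP; split => w /=; rewrite in_itv/= andbT.
Qed.

Lemma measurable_tail D : measurable_fun setT D ->
  measurable_fun [set: R] (fun r : R => P [set w | (r < D w)%R]).
Proof.
move=> mD.
pose mixin := isMeasurableFun.Build _ _ _ _ _ mD.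
pose D' : {RV P >-> R} := HB.pack D mixin.
have := ccdf_measurable D'.
congr measurable_fun; apply/funext => r; rewrite /ccdf /distribution /pushforward/=.
by congr (P _); apply/seteqP; split => w /=; rewrite in_itv/= andbT.
Qed.

Variables (D : T -> R) (p b : R).
Hypotheses (mD : measurable_fun setT D) (D_ge0 : forall w, 0 <= D w)
  (b_ge0 : 0 <= b)
  (tail : forall t : R, 0 < t -> (P [set w | (t < D w)%R] <= (b / t `^ p)%:E)%E).

(** The tail of [D - a] at [r] is at most [b / (r + a) `^ p], integrable at
    infinity since [1 < p]. *)
Lemma weak_tail_excess (a : R) : 1 < p -> 0 < a ->
  (\int[P]_w (Num.max (D w - a) 0)%R%:E <= (b * (a `^ (1 - p) / (p - 1)))%:E)%E.
Proof.
move=> p1 a0.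
have mX : measurable_fun setT (fun w => Num.max (D w - a) 0).
  by apply: measurable_maxr => //; exact: measurable_funB.
rewrite ge0_integral_ccdf//; last by move=> w; rewrite le_max lexx orbT.
pose F (r : R) := - (b * (r + a) `^ (1 - p) / (p - 1)).
pose f (r : R) := b * (r + a) `^ (- p).
have f0 r : 0 <= f r by rewrite mulr_ge0// powR_ge0.
have dsh (r : R) : is_derive r 1 (fun s : R => s + a) 1.
  by apply: is_derive_eq; rewrite addr0.
have dpow (q r : R) : 0 <= r ->
    is_derive r 1 (fun s => (s + a) `^ q) (q * (r + a) `^ (q - 1)).
  move=> r0; have ra : 0 < r + a by lra.
  have := @is_derive1_comp R (fun s => s `^ q) (fun s => s + a) r _ _
    (is_derive1_powR q ra) (dsh r).
  by rewrite mulr1.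
have dF (r : R) : 0 <= r -> is_derive r 1 F (f r).
  move=> r0; have := dpow (1 - p) r r0 => H.
  rewrite /F (_ : (fun _ => _) =
    - ((b / (p - 1)) *: (fun s => (s + a) `^ (1 - p)))); last first.
    by apply/funext => s/=; rewrite !fctE/= /GRing.scale/=; ring.
  apply: is_derive_eq; rewrite /f /GRing.scale/=.
  rewrite (_ : 1 - p - 1 = - p); last by ring.
  by field; lra.
have dcont (g : R -> R) (r : R) : derivable g r 1 -> {for r, continuous g}.
  by move=> /derivable1_diffP; exact: differentiable_continuous.
have cf (r : R) : 0 <= r -> {for r, continuous f}.
  move=> r0; have := dpow (- p) r r0 => -[dd _].
  apply: cvgM; first exact: cvg_cst.
  exact: dcont dd.
have -> : (b * (a `^ (1 - p) / (p - 1)))%:E = (0%:E - (F 0)%:E)%E.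
  by rewrite -EFinB /F sub0r opprK add0r mulrA.
rewrite -(@ge0_continuous_FTC2y _ f F 0 0).
- apply: ge0_le_integral => //=.
  + by apply/measurable_funTS; exact: measurable_tail.
  + apply/measurable_EFinP; apply: measurable_funTS.
    apply: measurable_funM => //.
    apply: (measurableT_comp (@measurable_powR R (- p))).
    exact: measurable_funD.
  + move=> r; rewrite in_itv/= andbT => r0.
    have ra : 0 < r + a by lra.
    rewrite /f powRN; apply: le_trans (tail ra); apply: le_measure; rewrite ?inE.
    * by rewrite -[X in measurable X]setTI; apply: measurable_fun_ltr.
    * by rewrite -[X in measurable X]setTI; apply: measurable_fun_ltr.
    * move=> w /=; rewrite lt_max => /orP[|]; lra.
- by [].
- apply/continuous_within_itvcyP; split.
    by move=> r; rewrite in_itv/= andbT => /ltW; exact: cf.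
  by apply: cvg_within_filter; exact: cf.
- rewrite -oppr0; apply: cvgN.
  rewrite (_ : (fun _ => _) =
    (fun r => (b / (p - 1)) * ((r + a) `^ (p - 1))^-1)); last first.
    by apply/funext => r; rewrite -powRN opprB; ring.
  rewrite -(mulr0 (b / (p - 1))); apply: cvgM; first exact: cvg_cst.
  apply/gtr0_cvgV0.
    by near=> r; apply: powR_gt0; rewrite addr_gt0//; near: r;
      apply: nbhs_pinfty_gt; exact: num_real.
  apply/cvgryPge => A; near=> r.
  have r0 : 0 <= r by near: r; apply: nbhs_pinfty_ge; exact: num_real.
  apply: (le_trans (ler_norm A)).
  have -> : `|A| = (`|A| `^ (p - 1)^-1) `^ (p - 1).
    by rewrite -powRrM mulVf ?powRr1//; lra.
  apply: ge0_ler_powR; rewrite ?nnegrE ?powR_ge0//; try lra.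
  apply: (@le_trans _ _ r); last by lra.
  by near: r; apply: nbhs_pinfty_ge; exact: num_real.
- by move=> r r0; have [] := dF r (ltW r0).
- have [dd _] := dF 0 (lexx 0).
  by apply: cvg_within_filter; exact: dcont dd.
- move=> r; rewrite in_itv/= andbT => /ltW r0; rewrite derive1E.
  by have [_ ->] := dF r r0.
Unshelve. all: by end_near. Qed.

(** The tail of the truncated square at [r] is at most [b * r `^ (- (p / 2))] and
    vanishes beyond [a ^+ 2]; the exponent is integrable at 0 since [p < 2]. *)
Lemma weak_tail_truncated_sqr (a : R) : p < 2 -> 0 < a ->
  (\int[P]_w (Num.min (D w) a ^+ 2)%R%:E <= (b * (2 * a `^ (2 - p) / (2 - p)))%:E)%E.
Proof.
move=> p2 a0.
have mX : measurable_fun setT (fun w => Num.min (D w) a ^+ 2).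
  by apply: measurable_funX; exact: measurable_minr.
rewrite ge0_integral_ccdf//; last by move=> w; exact: sqr_ge0.
pose q := p / 2.
have q1 : 0 < 1 - q by rewrite /q; lra.
pose F (r : R) := b / (1 - q) * r `^ (1 - q).
pose f (r : R) := b * r `^ (- q).
have f0 r : 0 <= f r by rewrite mulr_ge0// powR_ge0.
have F0 r : 0 <= F r by rewrite !mulr_ge0// ?invr_ge0 ?powR_ge0// ltW.
have dF (r : R) : 0 < r -> is_derive r 1 F (f r).
  move=> r0; have := is_derive1_powR (1 - q) r0 => H.
  rewrite /F (_ : (fun _ => _) = (b / (1 - q)) *: (fun s => s `^ (1 - q)))//.
  apply: is_derive_eq; rewrite /f /GRing.scale/=.
  rewrite (_ : 1 - q - 1 = - q); last by ring.
  by field; lra.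
have dcont (g : R -> R) (r : R) : derivable g r 1 -> {for r, continuous g}.
  by move=> /derivable1_diffP; exact: differentiable_continuous.
have cf (r : R) : 0 < r -> {for r, continuous f}.
  move=> r0; have [dd _] := is_derive1_powR (- q) r0.
  by apply: cvgM; [exact: cvg_cst|exact: dcont dd].
have mf : measurable_fun setT f.
  by apply: measurable_funM => //; exact: measurable_powR.
have mfr (I : set R) : measurable I -> measurable_fun setT (f \_ I).
  by move=> mI; apply/(measurable_restrictT f mI); exact: measurable_funTS.
have Fa : F (a ^+ 2) = b * (2 * a `^ (2 - p) / (2 - p)).
  rewrite /F -powR_mulrn ?(ltW a0)// -powRrM.
  rewrite (_ : 2%:R * (1 - q) = 2 - p); last by rewrite /q; field.
  by rewrite /q; field; lra.
rewrite -Fa; apply/lee_addgt0Pr => e e0.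
(* The density is unbounded at 0, so the tail is bounded by 1 on a short initial
   interval [0, c], which contributes at most e. *)
pose c := Num.min e (a ^+ 2 / 2).
have a20 : 0 < a ^+ 2 by rewrite exprn_gt0.
have c0 : 0 < c by rewrite lt_min e0/= divr_gt0.
have ca : c < a ^+ 2 by rewrite gt_min; apply/orP; right; lra.
have ce : c <= e by rewrite ge_min lexx.
have intf : (\int[mu]_(r in `[c, (a ^+ 2)%R]) (f r)%:E = (F (a ^+ 2)%R)%:E - (F c)%:E)%E.
  apply: continuous_FTC2 => //.
  - apply/continuous_within_itvP => //; split.
    + by move=> r; rewrite in_itv/= => /andP[cr _]; apply: cf; exact: lt_trans cr.
    + by apply: cvg_within_filter; exact: cf.
    + by apply: cvg_within_filter; exact: cf.
  - split.
    + move=> r; rewrite in_itv/= => /andP[cr _].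
      by have [] := dF r (lt_trans c0 cr).
    + by apply: cvg_within_filter; apply: dcont; have [] := dF c c0.
    + by apply: cvg_within_filter; apply: dcont; have [] := dF _ a20.
  - move=> r; rewrite in_itv/= => /andP[cr _]; rewrite derive1E.
    by have [_ ->] := dF r (lt_trans c0 cr).
apply: (@le_trans _ _ (\int[mu]_(r in `[0%R, +oo[)
    ((\1_`[0%R, c] r)%:E + ((f \_ `[c, (a ^+ 2)%R]) r)%:E))%E).
  apply: ge0_le_integral => //=.
  - by apply/measurable_funTS; exact: measurable_tail.
  - apply: measurable_funTS; apply: emeasurable_funD; apply/measurable_EFinP.
      exact: measurable_indic.
    by apply: mfr.
  move=> r; rewrite in_itv/= andbT => r0.
  have mr : measurable [set w | r < Num.min (D w) a ^+ 2].
    by rewrite -[X in measurable X]setTI; apply: measurable_fun_ltr.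
  have fr0 : (0 <= ((f \_ `[c, (a ^+ 2)%R]) r)%:E)%E.
    by rewrite lee_fin patchE; case: ifP.
  have [rc|cr] := leP r c.
    rewrite indicE mem_set/= ?in_itv/= ?r0//.
    by apply: (le_trans (probability_le1 P mr)); rewrite leeDl.
  have [ra|ar] := leP r (a ^+ 2).
    rewrite indicE memNset/= ?in_itv/=; last first.
      by apply/negP; rewrite negb_and -!ltNge cr orbT.
    rewrite add0e patchE mem_set/= ?in_itv/= ?(ltW cr)//.
    rewrite /f powRN /q.
    have rp : 0 < r by exact: lt_trans cr.
    have sr : 0 < Num.sqrt r by rewrite sqrtr_gt0.
    rewrite (_ : r `^ (p / 2) = Num.sqrt r `^ p); last first.
      by rewrite -powR12_sqrt// -powRrM mulrC.
    apply: le_trans (tail sr); apply: le_measure; rewrite ?inE//.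
      by rewrite -[X in measurable X]setTI; apply: measurable_fun_ltr.
    move=> w /= rw; rewrite -(@ltr_pXn2r _ 2)// ?nnegrE ?sqrtr_ge0//.
    rewrite sqr_sqrtr//; apply: (lt_le_trans rw).
    by rewrite ler_pXn2r// ?nnegrE ?ge_min ?lexx// le_min D_ge0 ltW.
  have -> : [set w | r < Num.min (D w) a ^+ 2] = set0.
    apply/seteqP; split => // w /= rw; have : a ^+ 2 < a ^+ 2; last by rewrite ltxx.
    apply: (lt_trans ar); apply: (lt_le_trans rw).
    rewrite ler_pXn2r ?nnegrE// ?ge_min ?lexx ?orbT ?(ltW a0)//.
    by rewrite le_min D_ge0 ltW.
  by rewrite measure0 adde_ge0// lee_fin.
rewrite ge0_integralD//=; last 3 first.
- by apply/measurable_EFinP; apply: measurable_funTS; exact: measurable_indic.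
- by move=> r _; rewrite lee_fin patchE; case: ifP.
- apply/measurable_EFinP; apply: measurable_funTS.
  by apply: mfr.
have -> : (\int[mu]_(r in `[0%R, +oo[) (\1_`[0%R, c] r)%:E = c%:E)%E.
  rewrite integral_indic//= setIidl; last first.
    by move=> r /=; rewrite !in_itv/= andbT => /andP[].
  by rewrite lebesgue_measure_itv/= lte_fin c0 sube0.
have -> : (\int[mu]_(r in `[0%R, +oo[) ((f \_ `[c, (a ^+ 2)%R]) r)%:E =
    (F (a ^+ 2)%R)%:E - (F c)%:E)%E.
  rewrite -intf -[in RHS](@setIidr _ `[0, +oo[ `[c, (a ^+ 2)%R]); last first.
    move=> r /=; rewrite !in_itv/= andbT => /andP[cr _].
    exact: le_trans (ltW c0) cr.
  by rewrite integral_mkcondr; apply: eq_integral => r _; rewrite !patchE; case: ifP.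
by rewrite -EFinB -!EFinD lee_fin; have := F0 c; lra.
Qed.

End weak_tail.

(** Adding the two pieces at level [2 * x] gives [Cp p] with room to spare: the
    factor [2 `^ (2 - p)] produced by the level is at most 2. *)
Lemma weak_tail_huber_rem d (T : measurableType d) {R : realType}
    (P : probability T R) (D : T -> R) (p b x : R) :
  measurable_fun setT D -> (forall w, 0 <= D w) -> 0 <= b ->
  (forall t : R, 0 < t -> (P [set w | (t < D w)%R] <= (b / t `^ p)%:E)%E) ->
  1 < p -> p < 2 -> 0 < x ->
  (\int[P]_w (huber_rem x (D w))%:E <= (Cp p * b * x `^ (2 - p))%:E)%E.
Proof.
move=> mD D0 b0 tail p1 p2 x0.
have x20 : 0 < 2 * x by lra.
under eq_integral do rewrite huber_remE// EFinD EFinM (EFinM (4 * x)).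
have mmin : measurable_fun setT (fun w => (Num.min (D w) (2 * x) ^+ 2)%:E).
  by apply/measurable_EFinP; apply: measurable_funX; exact: measurable_minr.
have mmax : measurable_fun setT (fun w => (Num.max (D w - 2 * x) 0)%:E).
  by apply/measurable_EFinP; apply: measurable_maxr => //; exact: measurable_funB.
have min0 w : (0 <= (Num.min (D w) (2 * x) ^+ 2)%:E)%E by rewrite lee_fin sqr_ge0.
have max0 w : (0 <= (Num.max (D w - 2 * x) 0)%:E)%E.
  by rewrite lee_fin le_max lexx orbT.
rewrite ge0_integralD//=; last 4 first.
- by move=> w _; rewrite mule_ge0// lee_fin.
- exact: measurable_funeM.
- by move=> w _; rewrite mule_ge0// lee_fin; lra.
- exact: measurable_funeM.
rewrite ge0_integralZl_EFin//.
rewrite ge0_integralZl_EFin//; last by lra.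
have p0 : 0 < p by lra.
have h1 := weak_tail_truncated_sqr mD D0 b0 tail p2 x20.
have h2 := weak_tail_excess mD b0 tail p1 x20.
have h4 : 0 <= 4 * x by lra.
apply: (le_trans (leeD (lee_wpmul2l _ h1) (lee_wpmul2l _ h2))); rewrite ?lee_fin//.
rewrite /Cp.
have -> : (2 * x) `^ (1 - p) = (2 * x) `^ (2 - p) / (2 * x).
  rewrite (_ : 1 - p = 2 - p - 1); last by ring.
  by rewrite [LHS]powRB ?powRr1 ?(ltW x20)// (gt_eqF x20) implybT.
rewrite powRM//; try lra.
set u := x `^ (2 - p); set v := 2 `^ (2 - p).
have v2 : v <= 2.
  by rewrite -[leRHS]powRr1// /v; apply: ler_powR; lra.
have u0 : 0 <= u by exact: powR_ge0.
have -> : 2 * (b * (2 * (v * u) / (2 - p))) + 4 * x * (b * (v * u / (2 * x) / (p - 1))) =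
    v * (b * u * (4 / (2 - p) + 2 / (p - 1))) by field; lra.
have -> : (4 * p / (p - 1) + 8 * p / (2 - p)) * b * u =
    2 * (b * u * (4 / (2 - p) + 2 / (p - 1)))
    + (p - 1) * (b * u * (8 / (2 - p) + 4 / (p - 1))) by field; lra.
have k1 : 0 <= 4 / (2 - p) + 2 / (p - 1) by apply: addr_ge0; apply: divr_ge0; lra.
have k2 : 0 <= 8 / (2 - p) + 4 / (p - 1) by apply: addr_ge0; apply: divr_ge0; lra.
apply: (@le_trans _ _ (2 * (b * u * (4 / (2 - p) + 2 / (p - 1))))).
  by apply: ler_wpM2r => //; rewrite !mulr_ge0.
by rewrite lerDl mulr_ge0 ?mulr_ge0//; lra.
Qed.

(** * Measurability of Lipschitz functions on separable spaces *)

Section lipschitz_measurable.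
Context {R : realType}.

Lemma measurable_fun_infty_o d (A : measurableType d) (g : A -> R) :
  (forall r : R, measurable [set a | g a < r]) -> measurable_fun setT g.
Proof.
move=> mg _; apply: (measurability _ (RGenInftyO.measurableE R)) => //.
move=> /= _ [_ [x ->] <-]; rewrite setTI.
by rewrite [X in measurable X](_ : _ = [set a | g a < x]).
Qed.

Lemma measurable_mdist (M : completeMetricType R) (y : M) :
  measurable_fun setT ((fun z : M => mdist y z) : borel M -> R).
Proof.
apply: measurable_fun_infty_o => r; apply: sub_sigma_algebra => /=.
have := @ballEmdist R M y r => <-.
rewrite openE => z; rewrite ballEmdist/= => zr; apply/nbhs_ballP.
exists (r - mdist y z) => /=; first by rewrite subr_gt0.
move=> t; rewrite !ballEmdist/= => zt.
by rewrite (le_lt_trans (metric_triangle _ z _))//; lra.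
Qed.

Lemma separable_enum (M : completeMetricType R) : separable M ->
  exists q : nat -> M, forall x (e : R), 0 < e -> exists k, mdist x (q k) < e.
Proof.
move=> [D /countable_injP[g ginj] dD].
exists (fun n => xget point [set x | D x /\ g x = n]) => x e e0.
have [] := dD (ball x e)^°.
- exists x; apply: nbhsx_ballx => //.
- exact: open_interior.
move=> z [/interior_subset xz Dz]; exists (g z).
have -> : xget point [set t | D t /\ g t = g z] = z.
  by case: xgetP => [t _ [Dt gt]|/(_ z)]; [apply: ginj; rewrite ?inE|case].
by move: xz; rewrite ballEmdist.
Qed.

(** A Lipschitz function of [m] points is measurable for the product of the Borel
    sigma-algebras: [f (Z a) < r] holds iff the Lipschitz upper bound on [f (Z a)]
    taken from some finite list of points of a countable dense set is below [r].
    Separability is what makes the union countable. *)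
Lemma measurable_lipschitz (M : completeMetricType R) (m : nat) (L : R)
    (f : (nat -> M) -> R) d (A : measurableType d) (Z : nat -> A -> borel M) :
  separable M -> 0 <= L ->
  (forall s s', `|f s - f s'| <= L * \sum_(i < m) mdist (s i) (s' i)) ->
  (forall i, (i < m)%N -> measurable_fun setT (Z i)) ->
  measurable_fun setT (fun a => f (fun i => Z i a)).
Proof.
move=> /separable_enum[q qdense] L0 flip mZ; apply: measurable_fun_infty_o => r.
pose qs (c : seq nat) i := q (nth 0 c i).
pose g c a := f (qs c) + L * \sum_(i < m) mdist (qs c i) (Z i a).
rewrite (_ : [set a | _] = \bigcup_c [set a | g c a < r]).
  apply: countable_bigcupT_measurable => // c.
  rewrite -[X in measurable X]setTI; apply: measurable_fun_ltr => //.
  apply: measurable_funD => //; apply: measurable_funM => //.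
  apply: measurable_sum => i.
  exact: (measurableT_comp (measurable_mdist _) (mZ i (ltn_ord i))).
apply/seteqP; split=> a /=.
- move=> fa; pose e := (r - f (fun i => Z i a)) / (2 * L * m%:R + 1).
  have den : 0 < 2 * L * m%:R + 1 by rewrite ltr_wpDl// !mulr_ge0.
  have e0 : 0 < e by rewrite divr_gt0// subr_gt0.
  have /choice[k kP] := fun i => qdense (Z i a) e e0.
  (* The upper bound exceeds f (Z a) by at most 2 * L * m * e. *)
  exists (mkseq k m) => //=; rewrite /g.
  have dk : \sum_(i < m) mdist (qs (mkseq k m) i) (Z i a : M) <= m%:R * e.
    rewrite mulr_natl -[X in _ *+ X]card_ord -sumr_const; apply: ler_sum => i _.
    by rewrite /qs nth_mkseq// metric_sym ltW.
  have := flip (qs (mkseq k m)) (fun i => Z i a).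
  rewrite ler_norml => /andP[_ fq].
  have Ldk := ler_wpM2l L0 dk.
  have : 2 * (L * (m%:R * e)) < r - f (fun i => Z i a); last by lra.
  rewrite /e (_ : 2 * (L * (m%:R * _)) =
    (r - f (fun i => Z i a)) * ((2 * L * m%:R) / (2 * L * m%:R + 1))); last by ring.
  by rewrite gtr_pMr ?subr_gt0// ltr_pdivrMr// mul1r ltrDl.
- move=> [c _] /=; rewrite /g/=; apply: le_lt_trans.
  have := flip (fun i => Z i a) (qs c); rewrite ler_norml => /andP[_].
  under eq_bigr do rewrite metric_sym; lra.
Qed.

End lipschitz_measurable.

(** * Weak moments and mean distances *)

Section weak_moment_lemmas.
Context d (T : measurableType d) {R : realType} (P : probability T R).
Variables (Z : T -> \bar R) (p A : R).
Hypothesis ZA : (weak_moment P p Z <= A%:E)%E.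

Lemma weak_moment_tail (t : R) : 0 < t ->
  (P [set w | t%:E < `|Z w|] <= (A / t `^ p)%:E)%E.
Proof.
move=> t0; have tp : 0 < t `^ p by exact: powR_gt0.
rewrite EFinM muleC lee_pdivlMl//.
apply: le_trans ZA; apply: ereal_sup_ubound.
by exists t => /=.
Qed.

Lemma weak_moment_ge0 : 0 <= A.
Proof.
rewrite -lee_fin; apply: le_trans ZA.
apply: (@le_trans _ _ ((1 `^ p)%:E * P [set w | 1%:E < `|Z w|])%E).
  by rewrite mule_ge0// lee_fin powR_ge0.
by apply: ereal_sup_ubound; exists 1 => /=.
Qed.

(** If [Z] were infinite everywhere, its tail would be 1 at every level, and the
    bound would fail at level [A + 1]. *)
Lemma weak_moment_exists_lty : 1 < p -> exists w, (`|Z w| < +oo)%E.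
Proof.
move=> p1; have A0 := weak_moment_ge0.
apply: contrapT => /forallNP Zoo.
have := @weak_moment_tail (A + 1).
rewrite (_ : [set w | _] = setT); last first.
  apply/seteqP; split => // w _ /=.
  by rewrite (@lt_le_trans _ _ +oo%E)// ?ltry// leNgt; apply/negP/Zoo.
rewrite probability_setT lee_fin ler_pdivlMr ?powR_gt0 ?mul1r; [|lra..].
have : A + 1 <= (A + 1) `^ p.
  by rewrite -[leLHS]powRr1; [apply: ler_powR|]; lra.
by move=> h /(_ ltac:(lra)); lra.
Qed.

End weak_moment_lemmas.

Section mean_distance.
Context {R : realType} (M : completeMetricType R) (sepM : separable M).
Variables (Q : probability (borel M) R) (C : R) (y0 : M).
Hypotheses (C_ge0 : 0 <= C)
  (Q_y0 : (\int[Q]_y (C * @mdist R M y0 y)%:E < +oo)%E).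

(** The real-valued version of the functions [G_init] and [G_noise]: by the
    triangle inequality, finiteness at [y0] makes them finite everywhere. *)
Definition mean_dist (y : M) : R := (\int[Q]_z (C * @mdist R M y z))%R.

Lemma integrable_dist y : Q.-integrable setT (fun z => (C * @mdist R M y z)%:E).
Proof.
have mC (x : M) : measurable_fun setT ((fun z : M => (C * mdist x z)%:E) : borel M -> _).
  by apply/measurable_EFinP/measurable_funM => //; exact: measurable_mdist.
have d0 (x z : M) : (0 <= (C * mdist x z)%:E)%E by rewrite lee_fin mulr_ge0// mdist_ge0.
have i0 : Q.-integrable setT (fun z => (C * @mdist R M y0 z)%:E).
  apply/integrableP; split; first exact: mC.
  by under eq_integral do rewrite gee0_abs//.
apply: (@le_integrable _ _ _ Q _ measurableT _
    (fun z => (C * mdist y y0)%:E + (C * @mdist R M y0 z)%:E)%E) => //.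
  move=> z _; rewrite -EFinD !gee0_abs//; last first.
    by rewrite lee_fin addr_ge0// mulr_ge0// mdist_ge0.
  by rewrite lee_fin -mulrDr ler_wpM2l// metric_triangle.
by apply: integrableD => //; exact: finite_measure_integrable_cst.
Qed.

Lemma mean_distE y : (\int[Q]_z (C * @mdist R M y z)%:E = (mean_dist y)%:E)%E.
Proof.
rewrite /mean_dist /Rintegral fineK//.
exact: integrable_fin_num (integrable_dist y).
Qed.

Lemma mean_dist_ge0 y : 0 <= mean_dist y.
Proof. by apply: Rintegral_ge0 => z _; rewrite mulr_ge0// mdist_ge0. Qed.

Lemma mean_dist_le y z : mean_dist y <= C * mdist y z + mean_dist z.
Proof.
have -> : C * mdist y z = (\int[Q]_x (C * mdist y z))%R.
  by rewrite Rintegral_cst//= probability_setT mulr1.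
rewrite -RintegralD//; last 2 first.
- exact: finite_measure_integrable_cst.
- exact: integrable_dist.
apply: le_Rintegral => //; first exact: integrable_dist.
  exact: (integrableD measurableT
    (finite_measure_integrable_cst Q (C * mdist y z) measurableT) (integrable_dist z)).
by move=> x _; rewrite -mulrDr ler_wpM2l// metric_triangle.
Qed.

Lemma measurable_mean_dist : measurable_fun setT (mean_dist : borel M -> R).
Proof.
apply: (@measurable_lipschitz _ _ 1 C (fun s => mean_dist (s 0%N)) _ _
  (fun _ z => z)) => //.
move=> s s'; rewrite big_ord1 ler_norml.
have := mean_dist_le (s 0%N) (s' 0%N); have := mean_dist_le (s' 0%N) (s 0%N).
rewrite (metric_sym (s' 0%N)); lra.
Qed.

Lemma integrable_mean_dist : Q.-integrable setT (fun z => (mean_dist z)%:E).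
Proof.
apply: (@le_integrable _ _ _ Q _ measurableT _
    (fun z => (C * @mdist R M y0 z)%:E + (mean_dist y0)%:E)%E) => //.
- by apply/measurable_EFinP; exact: measurable_mean_dist.
- move=> z _; rewrite -EFinD !gee0_abs ?lee_fin ?mean_dist_ge0//; last first.
    by rewrite addr_ge0 ?mean_dist_ge0// mulr_ge0// mdist_ge0.
  by rewrite metric_sym mean_dist_le.
apply: integrableD => //; first exact: integrable_dist.
exact: finite_measure_integrable_cst.
Qed.

Variables (g : M -> R) (a : R).
Hypotheses (a_ge0 : 0 <= a) (g_lip : forall y z, `|g y - g z| <= a * (C * mdist y z)).

Lemma lipschitz_integrable : Q.-integrable setT (fun z => (g z)%:E).
Proof.
apply: (@le_integrable _ _ _ Q _ measurableT _
    (fun z => a%:E * (C * @mdist R M y0 z)%:E + `|g y0|%:E)%E) => //.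
- apply/measurable_EFinP.
  apply: (@measurable_lipschitz _ _ 1 (a * C) (fun s => g (s 0%N)) _ _
    (fun _ z => z)) => //.
    exact: mulr_ge0.
  by move=> s s'; rewrite big_ord1 -mulrA.
- move=> z _; rewrite -EFinM -EFinD /= lee_fin.
  apply: le_trans (ler_norm _); have := g_lip z y0; rewrite metric_sym.
  by have := ler_normD (g z - g y0) (g y0); rewrite subrK; lra.
apply: integrableD => //; last exact: (finite_measure_integrable_cst Q `|g y0|).
by apply: integrableZl => //; exact: integrable_dist.
Qed.

(** The mean of [g] under [Q] is an average of values [g z], each at distance at
    most [a * (C * mdist y z)] from [g y]. *)
Lemma lipschitz_deviation y : `|g y - (\int[Q]_z g z)%R| <= a * mean_dist y.
Proof.
have ig := lipschitz_integrable.
have icst : Q.-integrable setT (EFin \o cst (g y)).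
  exact: finite_measure_integrable_cst.
have -> : g y - (\int[Q]_z g z)%R = (\int[Q]_z (g y - g z))%R.
  by rewrite RintegralB// Rintegral_cst//= probability_setT mulr1.
have iB : Q.-integrable setT (fun z => (g y - g z)%:E).
  exact: (integrableB measurableT icst ig).
apply: (le_trans (le_normr_Rintegral measurableT iB)).
rewrite /mean_dist -RintegralZl//; last exact: integrable_dist.
apply: le_Rintegral => //.
- exact: (integrable_abse iB).
- exact: (integrableZl measurableT a (integrable_dist y)).
Qed.

End mean_distance.

(** * Independence of the next noise from the past *)

Lemma integrable_comp_distribution d (T : measurableType d) {R : realType}
    (P : probability T R) dB (B : measurableType dB) (e : {RV P >-> B}) (h : B -> R) :
  (distribution P e).-integrable setT (EFin \o h) ->
  P.-integrable setT (fun w => (h (e w))%:E).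
Proof.
move=> ih; have /measurable_EFinP mh := measurable_int _ ih.
apply/integrableP; split; first exact/measurable_EFinP/measurableT_comp.
move/integrableP : ih => [_]; rewrite ge0_integral_distribution//.
by apply/measurable_EFinP; exact: measurableT_comp.
Qed.

Section independence_fubini.
Context d (T : measurableType d) {R : realType} (P : probability T R).
Context dA (A : measurableType dA) dB (B : measurableType dB).
Variables (U : {mfun T >-> A}) (e : {RV P >-> B}).
Hypothesis indep : forall S S', measurable S -> measurable S' ->
  P (U @^-1` S `&` e @^-1` S') = (P (U @^-1` S) * P (e @^-1` S'))%E.

(** Independence makes the joint law of [U] and [e] a product measure, so the
    expectation can be computed by integrating over the noise first. *)
Lemma indep_integral_eq0 (phi : A * B -> R) (h : B -> R) :
  measurable_fun setT phi -> (distribution P e).-integrable setT (EFin \o h) ->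
  (forall u y, `|phi (u, y)| <= h y) ->
  (forall u, (\int[distribution P e]_y (phi (u, y))%:E = 0)%E) ->
  (\int[P]_w (phi (U w, e w))%:E = 0)%E.
Proof.
move=> mphi ih phih phi0.
have mV : measurable_fun setT (fun w => (U w, e w)).
  exact: measurable_fun_pair.
pose Vmix := isMeasurableFun.Build _ _ _ _ _ mV.
pose V : {mfun T >-> (A * B)%type} := HB.pack (fun w => (U w, e w)) Vmix.
have mEphi : measurable_fun setT (EFin \o phi) by exact/measurable_EFinP.
have /measurable_EFinP mh := measurable_int _ ih.
have iV : P.-integrable setT ((EFin \o phi) \o V).
  apply: (@le_integrable _ _ _ P _ measurableT _ (EFin \o (h \o e))).
  - exact: measurableT_comp.
  - move=> w _ /=; rewrite lee_fin (le_trans (phih _ _))//; exact: ler_norm.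
  exact: integrable_comp_distribution.
rewrite -[LHS](@integral_distribution _ _ _ _ _ P V (EFin \o phi))//.
pose m1 := distribution P U; pose m2 := distribution P e.
have VE S : measurable S -> S `<=` setT -> distribution P V S = (m1 \x m2)%E S.
  move=> mS _; apply/esym; apply: product_measure_unique mS => S1 S2 mS1 mS2.
  exact: indep.
rewrite (eq_measure_integral _ VE).
rewrite -integral12_prod_meas1//=; last first.
  apply/integrable12ltyP => //.
  apply: (@le_lt_trans _ _ (\int[m1]_x \int[m2]_y (h y)%:E)%E).
    apply: ge0_le_integral => //.
    - by move=> x _; exact: integral_ge0.
    - apply: (measurable_fun_fubini_tonelli_F (fun z => `|(phi z)%:E|)%E) => //.
      exact: measurableT_comp.
    - move=> x _; apply: ge0_le_integral => //.
      + by apply/measurableT_comp => //; apply/measurable_EFinP; exact: measurableT_comp.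
      + exact/measurable_EFinP.
      + by move=> y _; rewrite lee_fin.
  rewrite integral_cst//= probability_setT mule1.
  exact: (integrable_lty measurableT ih).
rewrite /fubini_F/=; under eq_integral do rewrite phi0.
by rewrite integral0.
Qed.

End independence_fubini.

Section history.
Context dE dY d (E : measurableType dE) (Y : measurableType dY)
  (T : measurableType d) {R : realType} (P : probability T R).
Variables (X1 : {RV P >-> E}) (eps : nat -> {RV P >-> Y}).

Let bigcap_full (I : Type) (J : set I) (F : I -> set T) :
  (forall i, F i = setT) -> \bigcap_(i in J) F i = setT.
Proof. by move=> FT; apply/seteqP; split => // w _ i _; rewrite FT. Qed.

(** A pi-system generating the sigma-algebra of [X1, eps 2, ..., eps m.+1], the
    variables which determine the first [m.+1] states of the chain. *)
Definition history (m : nat) : set (set T) :=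
  [set S | exists (A0 : set E) (A : nat -> set Y),
    [/\ measurable A0, forall i, measurable (A i) &
        S = X1 @^-1` A0 `&`
          \bigcap_(i in [set i | (2 <= i < m.+2)%N]) (eps i @^-1` A i)]].

Let mpre d1 d2 (S1 : measurableType d1) (S2 : measurableType d2) (g : {mfun S1 >-> S2})
  (A : set S2) : measurable A -> measurable (g @^-1` A).
Proof. by move=> mA; rewrite -[X in measurable X]setTI; exact: measurable_funP. Qed.

Lemma history_sub_measurable m : history m `<=` measurable.
Proof.
move=> _ [A0 [A [mA0 mA ->]]]; apply: measurableI; first exact: mpre.
by apply: bigcap_measurableType => i _; exact: mpre.
Qed.

Lemma history_setI_closed m : setI_closed (history m).
Proof.
move=> _ _ [A0 [A [mA0 mA ->]]] [B0 [B [mB0 mB ->]]].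
exists (A0 `&` B0), (fun i => A i `&` B i); split.
- exact: measurableI.
- by move=> i; exact: measurableI.
- rewrite setIACA; congr (_ `&` _); apply/seteqP; split => w.
  + by move=> [Aw Bw] i /= im; split; [exact: Aw|exact: Bw].
  + by move=> ABw; split => i im; have [] := ABw i im.
Qed.

Lemma measurable_history_X1 m :
  measurable_fun setT (X1 : g_sigma_algebraType (history m) -> E).
Proof.
move=> _ A mA; rewrite setTI; apply: sub_sigma_algebra.
exists A, (fun=> setT); split => //.
by rewrite bigcap_full ?setIT.
Qed.

Lemma measurable_history_eps m i : (2 <= i < m.+2)%N ->
  measurable_fun setT (eps i : g_sigma_algebraType (history m) -> Y).
Proof.
move=> im _ A mA; rewrite setTI; apply: sub_sigma_algebra.
exists setT, (fun j => if j == i then A else setT); split => //.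
  by move=> j; case: ifP.
rewrite preimage_setT setTI; apply/seteqP; split => w /=.
  by move=> Aw j _ /=; case: eqP => // ->.
by move=> /(_ i im); rewrite /= eqxx.
Qed.

Hypotheses (eps_indep : mutually_independent [set i | (1 <= i)%N] eps)
  (X1_indep : independent_of_family X1 [set i | (2 <= i)%N] eps).

(** The two sides are finite measures in [S], so it suffices to compare them on
    the generating pi-system, where both hypotheses are product formulas. *)
Lemma history_indep_eps m S B : <<s history m >> S -> measurable B ->
  P (S `&` eps m.+2 @^-1` B) = (P S * P (eps m.+2 @^-1` B))%E.
Proof.
move=> + mB; set D := eps m.+2 @^-1` B; have mD : measurable D by exact: mpre.
have PD : P D \is a fin_num by exact: fin_num_measure.
pose c := fine (P D); have c0 : 0 <= c by exact: fine_ge0.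
pose m1 := mrestr P mD; pose m2 := mscale (NngNum c0) P.
suff : forall S, <<s history m >> S -> m1 S = m2 S.
  by move=> H /H; rewrite /m1 /mrestr /m2 /mscale/= /c fineK// muleC.
apply: (@g_sigma_algebra_measure_unique _ _ _ _ (@history_sub_measurable m) (fun=> setT)).
- by move=> i; exists setT, (fun=> setT); split => //; rewrite bigcap_full ?setIT.
- by rewrite bigcup_const.
- exact: history_setI_closed.
- move=> _ [A0 [A [mA0 mA ->]]].
  set W := \bigcap_(i in _) _.
  rewrite -[LHS]/(P (X1 @^-1` A0 `&` W `&` D)) -[RHS]/(c%:E * P (X1 @^-1` A0 `&` W))%E.
  rewrite /c fineK//.
  pose J := [fset i in iota 2 m]%fset.
  have JE : [set` J] = [set i | (2 <= i < m.+2)%N].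
    by apply/seteqP; split => i /=; rewrite !inE mem_iota addSn addSn add0n.
  pose A' i := if i == m.+2 then B else A i.
  have mA' i : measurable (A' i) by rewrite /A'; case: ifP.
  have WE : W = \bigcap_(i in [set` J]) (eps i @^-1` A' i).
    rewrite JE; apply: eq_bigcapr => i /= /andP[_ im].
    by rewrite /A' (ltn_eqF im).
  have mJ : m.+2 \notin J by rewrite !inE mem_iota addSn addSn add0n ltnn andbF.
  have WDE : W `&` D = \bigcap_(i in [set` (m.+2 |` J)%fset]) (eps i @^-1` A' i).
    rewrite WE; apply/seteqP; split => [w [Ww Dw] i|w Ww].
      rewrite /= !inE => /orP[/eqP ->|iJ]; first by rewrite /A' eqxx.
      by apply: Ww; rewrite /= !inE.
    split; first by move=> i iJ; apply: Ww; rewrite /= in_fsetU iJ orbT.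
    by have := Ww m.+2; rewrite /= !inE eqxx /A' eqxx; exact.
  have PW : P W = (\prod_(i <- J) P (eps i @^-1` A' i))%E.
    by rewrite WE eps_indep// JE => i /= /andP[/ltnW].
  have PWD : P (W `&` D) = (P D * P W)%E.
    rewrite WDE eps_indep//; last first.
      by move=> i; rewrite /= !inE mem_iota => /orP[/eqP ->//|/andP[/ltnW]].
    by rewrite big_fsetU1//= -PW /A' eqxx.
  have sWD : sigma_generated [set i | (2 <= i)%N] eps (W `&` D).
    rewrite WDE; apply: (@bigcap_measurableType _ (g_sigma_algebraType
      (\bigcup_(i in [set i | (2 <= i)%N]) preimage_set_system setT (eps i) measurable))).
    move=> i; rewrite /= !inE mem_iota => iJ; apply: sub_sigma_algebra.
    exists i; first by case/orP: iJ => [/eqP ->//|/andP[]].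
    by exists (A' i) => //; rewrite setTI.
  have sW : sigma_generated [set i | (2 <= i)%N] eps W.
    rewrite WE; apply: (@bigcap_measurableType _ (g_sigma_algebraType
      (\bigcup_(i in [set i | (2 <= i)%N]) preimage_set_system setT (eps i) measurable))).
    move=> i; rewrite /= !inE mem_iota => /andP[i2 _]; apply: sub_sigma_algebra.
    by exists i => //; exists (A' i) => //; rewrite setTI.
  rewrite -setIA X1_indep// PWD X1_indep//.
  by rewrite muleCA.
- by move=> k; rewrite -[X in (X < _)%E]/(P (setT `&` D)) setTI -ge0_fin_numE.
Qed.

End history.

(** * One step of a martingale through the Huber function *)

(** Markov's inequality, since [huber x s] is at least [x ^+ 2] when
    [x <= `|s|]. *)
Lemma huber_markov d (T : measurableType d) {R : realType}
    (P : probability T R) (Z : T -> R) (x : R) : measurable_fun setT Z -> 0 < x ->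
  ((x ^+ 2)%:E * P [set w | (x < `|Z w|)%R] <= \int[P]_w (huber x (Z w))%:E)%E.
Proof.
move=> mZ x0; set A := [set w | _].
have mA : measurable A.
  rewrite -[A]setTI; apply: measurable_fun_ltr => //.
  exact: measurableT_comp.
have <- : (\int[P]_w (\1_A w)%:E = P A)%E by rewrite integral_indic// setIT.
rewrite -ge0_integralZl_EFin ?sqr_ge0//; last exact/measurable_EFinP.
apply: ge0_le_integral => //.
- by move=> w _; rewrite mule_ge0// lee_fin sqr_ge0.
- by apply: measurable_funeM; exact/measurable_EFinP.
- by apply/measurable_EFinP; exact: (measurableT_comp (measurable_huber x)).
- move=> w _; rewrite -EFinM lee_fin indicE.
  case: (boolP (w \in A)) => [/set_mem xZ|_]; last by rewrite mulr0 huber_ge0.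
  by rewrite mulr1 huber_ge// ltW.
Qed.

(** Integrates [huber_add]: the linear term has mean zero because the increment
    is orthogonal to bounded functions of the past, and the remainder is monotone,
    hence controlled by the tail of the dominating variable. *)
Lemma huber_martingale_step d (T : measurableType d) {R : realType}
    (P : probability T R) (V xi D : T -> R) (c p b x : R) :
  P.-integrable setT (EFin \o V) -> P.-integrable setT (EFin \o xi) ->
  measurable_fun setT D -> (forall w, `|xi w| <= D w) ->
  0 <= b -> (forall t : R, 0 < t -> (P [set w | (t < D w)%R] <= (b / t `^ p)%:E)%E) ->
  1 < p -> p < 2 -> 0 < x ->
  (\int[P]_w (2 * clamp x (V w - c) * xi w)%:E = 0)%E ->
  (\int[P]_w (huber x (V w + xi w - c))%:E <=
   \int[P]_w (huber x (V w - c))%:E + (Cp p * b * x `^ (2 - p))%:E)%E.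
Proof.
move=> iV ixi mD xiD b0 tail p1 p2 x0 orth.
have D0 w : 0 <= D w by exact: le_trans (xiD w).
have /measurable_EFinP mV := measurable_int _ iV.
have /measurable_EFinP mxi := measurable_int _ ixi.
have mVc : measurable_fun setT (fun w => V w - c) by exact: measurable_funB.
have mH : measurable_fun setT (fun w => huber x (V w - c)).
  exact: (measurableT_comp (measurable_huber x)).
have mcl : measurable_fun setT (fun w => clamp x (V w - c)).
  exact: (measurableT_comp (measurable_clamp x)).
have mR : measurable_fun setT (fun w => huber_rem x (D w)).
  exact: (measurableT_comp (measurable_huber_rem x)).
have bound := weak_tail_huber_rem mD D0 b0 tail p1 p2 x0.
have iR : P.-integrable setT (fun w => (huber_rem x (D w))%:E).
  apply/integrableP; split; first exact/measurable_EFinP.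
  under eq_integral do rewrite gee0_abs ?lee_fin ?huber_rem_ge0//.
  by apply: le_lt_trans bound _; rewrite ltry.
have iVc : P.-integrable setT (fun w => (V w - c)%:E).
  exact: (integrableB measurableT iV (finite_measure_integrable_cst P c measurableT)).
have iH : P.-integrable setT (fun w => (huber x (V w - c))%:E).
  apply: (@le_integrable _ _ _ P _ measurableT _ (fun w => (2 * x)%:E * (V w - c)%:E)%E).
  - exact/measurable_EFinP.
  - move=> w _; rewrite -EFinM !abse_EFin lee_fin ger0_norm ?huber_ge0//.
    by rewrite normrM [X in _ <= X * _]ger0_norm ?huber_le_norm// mulr_ge0// ltW.
  - exact: integrableZl.
have ig : P.-integrable setT (fun w => (2 * clamp x (V w - c) * xi w)%:E).
  apply: (@le_integrable _ _ _ P _ measurableT _ (fun w => (2 * x)%:E * (xi w)%:E)%E).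
  - apply/measurable_EFinP; apply: measurable_funM => //; exact: measurable_funM.
  - move=> w _; rewrite -EFinM !abse_EFin lee_fin !normrM ler_wpM2r//.
    by rewrite ler_wpM2l// (ger0_norm (ltW x0)) clamp_norm_le.
  - exact: integrableZl.
apply: (@le_trans _ _ (\int[P]_w ((huber x (V w - c))%:E +
   (2 * clamp x (V w - c) * xi w)%:E + (huber_rem x (D w))%:E))%E).
  apply: le_integral => //.
  - apply: (@le_integrable _ _ _ P _ measurableT _
      (fun w => (2 * x)%:E * (V w - c + xi w)%:E)%E).
    + apply/measurable_EFinP; apply: (measurableT_comp (measurable_huber x)).
      by apply: measurable_funB => //; exact: measurable_funD.
    + move=> w _; rewrite -EFinM !abse_EFin lee_fin ger0_norm ?huber_ge0//.
      rewrite normrM [X in _ <= X * _]ger0_norm; last by rewrite mulr_ge0// ltW.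
      by rewrite (addrAC (V w)) huber_le_norm.
    + apply: integrableZl => //; exact: (integrableD measurableT iVc ixi).
  - by apply: integrableD => //; exact: integrableD.
  - move=> w _; rewrite -!EFinD lee_fin addrAC.
    apply: (le_trans (huber_add _ _ x0)); rewrite lerD2l.
    by apply: le_huber_rem.
rewrite integralD//; last exact: integrableD.
by rewrite integralD// orth adde0 leeD2l.
Qed.

(** * The chain *)

Section chain.
Context {R : realType} (XX YY : completeMetricType R)
  (sepX : separable XX) (sepY : separable YY)
  d (T : measurableType d) (P : probability T R)
  (eps : nat -> {RV P >-> borel YY})
  (eps_indep : mutually_independent [set i | (1 <= i)%N] eps)
  (eps_id : identically_distributed [set i | (1 <= i)%N] eps)
  (X : nat -> {RV P >-> borel XX})
  (X1_indep : independent_of_family (X 1%N) [set i | (2 <= i)%N] eps)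
  (F : borel XX * borel YY -> borel XX)
  (F_meas : measurable_fun setT F)
  (X_chain : forall k, (2 <= k)%N -> forall w, X k w = F (X k.-1 w, eps k w))
  (rho C : R) (rho_ge0 : 0 <= rho) (C_gt0 : 0 < C)
  (F_contract : forall x x' : XX,
    ('E_P[fun w => @mdist R XX (F (x, eps 1%N w)) (F (x', eps 1%N w))]
      <= (rho * mdist x x')%:E)%E)
  (F_lip : forall (x : XX) (y y' : YY),
    @mdist R XX (F (x, y)) (F (x, y')) <= C * mdist y y').
Let Q := distribution P (eps 1%N).
Let QX := distribution P (X 1%N).
Variables (x0 : XX) (y0 : YY).
Hypotheses (Q_y0 : (\int[Q]_y (C * @mdist R YY y0 y)%:E < +oo)%E)
  (QX_x0 : (\int[QX]_x (1 * @mdist R XX x0 x)%:E < +oo)%E).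

Let C_ge0 : 0 <= C. Proof. exact: ltW. Qed.

(** The states of the chain, indexed from 0 as the arguments of the functional;
    infinite sequences avoid casts between tuples of different lengths. *)
Definition trajectory w : nat -> XX := fun i => X i.+1 w.

Definition extend (s : nat -> XX) m (y : YY) : nat -> XX :=
  fun i => if i == m.+1 then F (s m, y) else s i.

(** Unit Lipschitz constant in the first [m] coordinates, [a] in the next one; in
    particular the later coordinates have no influence. *)
Definition lip_last m (a : R) (f : (nat -> XX) -> R) := forall s s',
  `|f s - f s'| <= \sum_(i < m) mdist (s i) (s' i) + a * mdist (s m) (s' m).

(** Conditional expectation, given the first [m.+1] states, of a function of the
    first [m.+2] states. *)
Definition average (f : (nat -> XX) -> R) m (s : nat -> XX) : R :=
  (\int[Q]_y f (extend s m y))%R.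

Lemma lip_last_eq m a f s s' : lip_last m a f ->
  (forall i, (i <= m)%N -> s i = s' i) -> f s = f s'.
Proof.
move=> flip ss'; apply/eqP; rewrite -subr_eq0 -normr_le0 (le_trans (flip s s'))//.
rewrite ss'// mdistxx mulr0 addr0 big1// => i _.
by rewrite ss' ?mdistxx// ltnW.
Qed.

Lemma lip_last_lip m a f s s' : 1 <= a -> lip_last m a f ->
  `|f s - f s'| <= a * \sum_(i < m.+1) mdist (s i) (s' i).
Proof.
move=> a1 flip; apply: (le_trans (flip s s')).
rewrite big_ord_recr/= mulrDr lerD2r ler_peMl// sumr_ge0// => i _; exact: mdist_ge0.
Qed.

Lemma measurable_lip_last m a f dA (A : measurableType dA) (Z : nat -> A -> borel XX) :
  1 <= a -> lip_last m a f ->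
  (forall i, (i <= m)%N -> measurable_fun setT (Z i)) ->
  measurable_fun setT (fun w => f (fun i => Z i w)).
Proof.
move=> a1 flip mZ; apply: (measurable_lipschitz (m := m.+1) (L := a)) => //.
- by rewrite (le_trans _ a1).
- by move=> s s'; exact: lip_last_lip.
Qed.

Lemma extend_noise_lip m a f s y z : 0 <= a -> lip_last m.+1 a f ->
  `|f (extend s m y) - f (extend s m z)| <= a * (C * mdist y z).
Proof.
move=> a0 flip; apply: (le_trans (flip _ _)).
rewrite big1 ?add0r; last by move=> i _; rewrite /extend (ltn_eqF (ltn_ord i)) mdistxx.
by rewrite /extend eqxx ler_wpM2l.
Qed.

Lemma integrable_extend m a f s : 0 <= a -> lip_last m.+1 a f ->
  Q.-integrable setT (fun y => (f (extend s m y))%:E).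
Proof.
move=> a0 flip.
apply: (@lipschitz_integrable _ _ sepY Q C y0 C_ge0 Q_y0
  (fun y => f (extend s m y)) a) => // y z.
exact: extend_noise_lip.
Qed.

Lemma extend_deviation m a f s y : 0 <= a -> lip_last m.+1 a f ->
  `|f (extend s m y) - average f m s| <= a * mean_dist Q C y.
Proof.
move=> a0 flip.
apply: (@lipschitz_deviation _ _ sepY Q C y0 C_ge0 Q_y0
  (fun y => f (extend s m y)) a) => // y' z.
exact: extend_noise_lip.
Qed.

Lemma measurable_F2 (x : XX) : measurable_fun setT (fun y : borel YY => F (x, y)).
Proof.
apply: (@measurableT_comp _ _ _ _ _ _ F setT
  (fun y : borel YY => (x : borel XX, y))) => //.
exact: measurable_fun_pair.
Qed.

Lemma measurable_dist_F (x x' : XX) :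
  measurable_fun setT (fun y : borel YY => @mdist R XX (F (x, y)) (F (x', y))).
Proof.
apply: (@measurable_lipschitz _ XX 2 1 (fun s => mdist (s 0%N) (s 1%N)) _ _
  (fun i y => if i == 0%N then F (x, y) else F (x', y))) => //.
  move=> s s'; rewrite !big_ord_recl big_ord0/= /bump/= mul1r addr0 ler_norml.
  have := metric_triangle (s 0%N) (s' 0%N) (s 1%N).
  have := metric_triangle (s' 0%N) (s' 1%N) (s 1%N).
  have := metric_triangle (s' 0%N) (s 0%N) (s' 1%N).
  have := metric_triangle (s 0%N) (s 1%N) (s' 1%N).
  rewrite (metric_sym (s' 1%N) (s 1%N)) (metric_sym (s' 0%N) (s 0%N)); lra.
by move=> [|i] _ /=; exact: measurable_F2.
Qed.

Lemma contraction_law (x x' : XX) :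
  (\int[Q]_y (@mdist R XX (F (x, y)) (F (x', y)))%:E <= (rho * mdist x x')%:E)%E.
Proof.
rewrite ge0_integral_distribution//.
- by have := F_contract x x'; rewrite unlock.
- by apply/measurable_EFinP; exact: measurable_dist_F.
- by move=> y; rewrite lee_fin mdist_ge0.
Qed.

(** The new last coordinate of [average f m] acts directly, with constant 1, and
    through the next state, which contracts its effect by [rho]; this is the
    recursion [K_recl] satisfied by [K]. *)
Lemma lip_last_average m a f : 0 <= a -> lip_last m.+1 a f ->
  lip_last m (1 + rho * a) (average f m).
Proof.
move=> a0 flip s s'.
have is1 := integrable_extend s a0 flip.
have is2 := integrable_extend s' a0 flip.
have id : Q.-integrable setT (fun y => (@mdist R XX (F (s m, y)) (F (s' m, y)))%:E).
  apply/integrableP; split; first by apply/measurable_EFinP; exact: measurable_dist_F.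
  under eq_integral do rewrite gee0_abs ?lee_fin ?mdist_ge0//.
  by apply: le_lt_trans (contraction_law _ _) _; rewrite ltry.
have iB : Q.-integrable setT (fun y => (f (extend s m y) - f (extend s' m y))%:E).
  exact: (integrableB measurableT is1 is2).
rewrite /average -RintegralB//.
apply: (le_trans (le_normr_Rintegral measurableT iB)).
pose S := \sum_(i < m.+1) mdist (s i) (s' i).
have iS := finite_measure_integrable_cst Q S measurableT.
have iad : Q.-integrable setT
    (EFin \o (fun y => a * @mdist R XX (F (s m, y)) (F (s' m, y)))).
  exact: (integrableZl measurableT a id).
apply: (@le_trans _ _ (\int[Q]_y (S + a * @mdist R XX (F (s m, y)) (F (s' m, y)))%R)).
  apply: le_Rintegral => //.
  - exact: (integrable_abse iB).
  - exact: (integrableD measurableT iS iad).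
  - move=> y _; apply: (le_trans (flip _ _)).
    rewrite /extend eqxx lerD2r /S; apply: ler_sum => i _.
    by rewrite (ltn_eqF (ltn_ord i)).
rewrite RintegralD// Rintegral_cst//= probability_setT mulr1 RintegralZl//.
rewrite /S big_ord_recr/= mulrDl mul1r addrA lerD2l mulrAC [leRHS]mulrC ler_wpM2l//.
rewrite -lee_fin; apply: le_trans (contraction_law _ _).
by rewrite /Rintegral fineK//; exact: integrable_fin_num id.
Qed.

Local Notation past m := (g_sigma_algebraType (history (X 1%N) eps m)).

Lemma measurable_past_X m i : (i <= m)%N ->
  measurable_fun setT (X i.+1 : past m -> borel XX).
Proof.
elim: i => [_|i IH im]; first exact: measurable_history_X1.
rewrite (_ : (X i.+2 : past m -> borel XX) = (fun w => F (X i.+1 w, eps i.+2 w))).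
  apply: (measurableT_comp F_meas); apply: measurable_fun_pair.
    by apply: IH; exact: ltnW.
  by apply: measurable_history_eps; rewrite !ltnS im.
by apply/funext => w; rewrite X_chain.
Qed.

Lemma past_sub m : measurable_fun setT (id : T -> past m).
Proof.
move=> _ A mA; rewrite setTI preimage_id.
exact: (smallest_sub (@sigma_algebra_measurable _ T)
  (@history_sub_measurable _ _ _ _ _ _ _ _ (X 1%N) eps m) mA).
Qed.

Lemma eps_law k : (1 <= k)%N -> forall S, measurable S ->
  distribution P (eps k) S = Q S.
Proof. by move=> k1 S mS; exact: eps_id. Qed.

Lemma integrable_noise k b : (1 <= k)%N ->
  (distribution P (eps k)).-integrable setT (fun y => (b * mean_dist Q C y)%:E).
Proof.
move=> k1; apply/integrableP; split.
  apply/measurable_EFinP; apply: measurable_funM => //.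
  exact: measurable_mean_dist Q_y0.
rewrite (eq_measure_integral Q); last by move=> S mS _; exact: eps_law.
have := integrableZl measurableT b (integrable_mean_dist sepY C_ge0 Q_y0).
by move=> /integrableP[].
Qed.

(** A function of the past and of the next noise whose mean over the noise
    vanishes for every frozen past has expectation zero. *)
Lemma innovation_eq0 m (phi : T * borel YY -> R) (b : R) :
  measurable_fun setT (phi : past m * borel YY -> R) ->
  (forall w y, `|phi (w, y)| <= b * mean_dist Q C y) ->
  (forall w, (\int[Q]_y (phi (w, y))%:E = 0)%E) ->
  (\int[P]_w (phi (w, eps m.+2 w))%:E = 0)%E.
Proof.
move=> mphi phib phi0.
pose idmix := isMeasurableFun.Build _ _ _ _ _ (@past_sub m).
pose U : {mfun T >-> past m} := HB.pack (id : T -> past m) idmix.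
apply: (@indep_integral_eq0 _ _ _ P _ (past m) _ (borel YY) U (eps m.+2) _ phi
  (fun y => b * mean_dist Q C y)) => //.
- by move=> S B mS mB; apply: (history_indep_eps eps_indep X1_indep mS mB).
- exact: integrable_noise.
- by move=> w; rewrite (eq_measure_integral Q)// => S mS _; exact: eps_law.
Qed.

Lemma measurable_trajectory_past m a f : 1 <= a -> lip_last m a f ->
  measurable_fun setT ((fun w => f (trajectory w)) : past m -> R).
Proof.
move=> a1 flip.
have := @measurable_lip_last m a f _ (past m)
  (fun i => X i.+1 : past m -> borel XX) a1 flip.
by apply => i im; exact: measurable_past_X.
Qed.

Lemma measurable_extend_past m a f : 1 <= a -> lip_last m.+1 a f ->
  measurable_fun setT
    ((fun z => f (extend (trajectory z.1) m z.2)) : past m * borel YY -> R).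
Proof.
move=> a1 flip.
pose Z i (z : past m * borel YY) : borel XX := extend (trajectory z.1) m z.2 i.
have := @measurable_lip_last m.+1 a f _ (past m * borel YY)%type Z a1 flip.
apply => i im; rewrite /Z /extend.
case: eqP => [_|/eqP im'].
  apply: (measurableT_comp F_meas); apply: measurable_fun_pair => //.
  by apply: (measurableT_comp (measurable_past_X (leqnn m))).
apply: (@measurableT_comp _ _ _ _ _ _ (X i.+1 : past m -> borel XX)) => //.
by apply: measurable_past_X; rewrite -ltnS ltn_neqAle im' im.
Qed.

Lemma trajectory_extend m a f w : lip_last m.+1 a f ->
  f (trajectory w) = f (extend (trajectory w) m (eps m.+2 w)).
Proof.
move=> flip; apply: (lip_last_eq flip) => i im; rewrite /extend; case: eqP => // ->.
by rewrite /trajectory X_chain.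
Qed.

Variables (A1 A2 p : R).
Hypotheses (p_gt1 : 1 < p) (p_lt2 : p < 2) (A1_ge0 : 0 <= A1) (A2_ge0 : 0 <= A2)
  (tail1 : forall t : R, 0 < t ->
    (P [set w | (t < mean_dist QX 1 (X 1%N w))%R] <= (A1 / t `^ p)%:E)%E)
  (tail2 : forall k, (1 <= k)%N -> forall t : R, 0 < t ->
    (P [set w | (t < mean_dist Q C (eps k w))%R] <= (A2 / t `^ p)%:E)%E).

Lemma K_ge1 j : 1 <= K rho j.
Proof.
by rewrite /K big_nat_recl// expr0 lerDl sumr_ge0// => i _; exact: exprn_ge0.
Qed.

Lemma K_recl j : K rho j.+1 = 1 + rho * K rho j.
Proof.
rewrite /K big_nat_recl// expr0 mulr_sumr; congr (_ + _).
by apply: eq_bigr => i _; rewrite exprS.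
Qed.

Lemma tail_scale (Z : T -> R) (A k : R) : 0 < k ->
  (forall t : R, 0 < t -> (P [set w | (t < Z w)%R] <= (A / t `^ p)%:E)%E) ->
  forall t : R, 0 < t -> (P [set w | (t < k * Z w)%R] <= (A * k `^ p / t `^ p)%:E)%E.
Proof.
move=> k0 tail t t0; have := tail (t / k) (divr_gt0 t0 k0).
rewrite (_ : [set w | _] = [set w | (t < k * Z w)%R]); last first.
  by apply/seteqP; split => w /=; rewrite ltr_pdivrMr// mulrC.
move=> /le_trans; apply; rewrite lee_fin powRM ?invr_ge0 ?(ltW t0) ?(ltW k0)//.
rewrite -(powR_inv1 (ltW k0)) -powRrM mulN1r powRN.
by rewrite invfM invrK mulrCA mulrC mulrAC.
Qed.

Lemma average_dev_eq0 m a f s : 0 <= a -> lip_last m.+1 a f ->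
  (\int[Q]_y (f (extend s m y) - average f m s)%:E = 0)%E.
Proof.
move=> a0 flip; have ie := integrable_extend s a0 flip.
have icst := finite_measure_integrable_cst Q (average f m s) measurableT.
rewrite -[LHS]fineK; last first.
  exact: (integrable_fin_num measurableT (integrableB measurableT ie icst)).
rewrite -[fine _]/(\int[Q]_y (f (extend s m y) - average f m s))%R RintegralB//.
by rewrite Rintegral_cst//= probability_setT mulr1 subrr.
Qed.

(** Induction on the number of states, integrating out the last noise. The
    constant [K rho j] of the last coordinate is a parameter because averaging
    turns it into [K rho j.+1]. *)
Theorem chain_huber_bound m j f : lip_last m (K rho j) f ->
  P.-integrable setT (fun w => (f (trajectory w))%:E) /\
  forall x : R, 0 < x ->
  (\int[P]_w (huber x (f (trajectory w) - (\int[P]_w f (trajectory w))%R))%:E <=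
   (Cp p * x `^ (2 - p) * (A1 * K rho (j + m) `^ p +
     A2 * \sum_(2 <= k < m.+2) K rho (j + m.+1 - k) `^ p))%:E)%E.
Proof.
elim: m j f => [|m IH] j f flip; have Kj1 := K_ge1 j; have Kj0 : 0 < K rho j by lra.
  pose g (x : XX) := f (fun=> x).
  have fg w : f (trajectory w) = g (X 1%N w).
    by apply: (lip_last_eq flip) => -[].
  have glip y z : `|g y - g z| <= K rho j * (1 * mdist y z).
    by have := flip (fun=> y) (fun=> z); rewrite big_ord0 add0r mul1r.
  have ig := lipschitz_integrable sepX ler01 QX_x0 (ltW Kj0) glip.
  have dev := lipschitz_deviation sepX ler01 QX_x0 (ltW Kj0) glip.
  have igX : P.-integrable setT (fun w => (f (trajectory w))%:E).
    under eq_fun do rewrite fg.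
    exact: integrable_comp_distribution.
  pose c := (\int[QX]_x g x)%R.
  have -> : (\int[P]_w f (trajectory w))%R = c.
    rewrite /c /Rintegral (@integral_distribution _ _ _ _ _ P (X 1%N) (EFin \o g)).
    - by congr fine; apply: eq_integral => w _; rewrite fg.
    - exact: (measurable_int _ ig).
    - exact: integrable_comp_distribution.
  split => // x xpos.
  have b0 : 0 <= A1 * K rho j `^ p by rewrite mulr_ge0// powR_ge0.
  have mD : measurable_fun setT (fun w => K rho j * mean_dist QX 1 (X 1%N w)).
    apply: measurable_funM => //.
    exact: (measurableT_comp (measurable_mean_dist sepX ler01 QX_x0)).
  have icst := finite_measure_integrable_cst P c measurableT.
  have devD w : `|f (trajectory w) - c| <= K rho j * mean_dist QX 1 (X 1%N w).
    by rewrite fg dev.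
  have orth : (\int[P]_w (2 * clamp x (cst c w - c) * (f (trajectory w) - c))%:E = 0)%E.
    rewrite -[RHS](integral0 P setT); apply: eq_integral => w _ /=.
    rewrite subrr (_ : clamp x 0 = 0) ?mulr0 ?mul0r//.
    by case: (clamp_cases 0 xpos) => -[? ->]; lra.
  (* A single increment, started from the constant c. *)
  have := huber_martingale_step icst (integrableB measurableT igX icst) mD devD b0
    (tail_scale Kj0 tail1) p_gt1 p_lt2 xpos orth.
  under eq_integral do rewrite /= (addrC c) subrK.
  under [X in (X + _)%E]eq_integral do rewrite /= subrr huber0//.
  by rewrite integral0 add0e mulrAC big_geq// mulr0 addr0 addn0.
have avlip := lip_last_average (ltW Kj0) flip.
rewrite -K_recl in avlip.
have [iV IHb] := IH _ _ avlip.
pose V w := average f m (trajectory w).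
pose xi w := f (trajectory w) - V w.
pose D w := K rho j * mean_dist Q C (eps m.+2 w).
have xiE w : xi w = f (extend (trajectory w) m (eps m.+2 w)) - V w.
  by rewrite /xi (trajectory_extend _ flip).
have xiD w : `|xi w| <= D w by rewrite xiE; apply: (extend_deviation _ _ (ltW Kj0) flip).
have mfP : measurable_fun setT (fun w => f (trajectory w)).
  exact: (@measurable_lip_last _ _ _ _ _ (fun i => X i.+1) Kj1 flip).
have /measurable_EFinP mV := measurable_int _ iV.
have iD : P.-integrable setT (fun w => (D w)%:E).
  exact: (integrable_comp_distribution (integrable_noise (K rho j) (ltn0Sn m.+1))).
have /measurable_EFinP mD := measurable_int _ iD.
have ixi : P.-integrable setT (EFin \o xi).
  apply: (@le_integrable _ _ _ P _ measurableT _ _ _ _ iD).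
    by apply/measurable_EFinP; exact: measurable_funB.
  by move=> w _ /=; rewrite lee_fin (le_trans (xiD w))// ler_norm.
have fVxi w : f (trajectory w) = V w + xi w by rewrite /xi addrC subrK.
have mVpast : measurable_fun setT ((fun z => V z.1) : past m * borel YY -> R).
  apply: (@measurableT_comp _ _ _ _ _ _ (V : past m -> R)) => //.
  by apply: measurable_trajectory_past avlip; exact: K_ge1.
have mdev : measurable_fun setT
    ((fun z => f (extend (trajectory z.1) m z.2) - V z.1) : past m * borel YY -> R).
  by apply: measurable_funB => //; exact: measurable_extend_past flip.
have xi0 : (\int[P]_w (xi w)%:E = 0)%E.
  under eq_integral do rewrite xiE.
  apply: (innovation_eq0 (b := K rho j)
    (phi := fun z => f (extend (trajectory z.1) m z.2) - V z.1)) => //.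
    by move=> w y; exact: (extend_deviation _ _ (ltW Kj0) flip).
  by move=> w; exact: (average_dev_eq0 (trajectory w) (ltW Kj0) flip).
have ifP : P.-integrable setT (fun w => (f (trajectory w))%:E).
  under eq_fun do rewrite fVxi.
  exact: (integrableD measurableT iV ixi).
pose c := (\int[P]_w V w)%R.
have -> : (\int[P]_w f (trajectory w))%R = c.
  rewrite /c /Rintegral; congr fine; under eq_integral do rewrite fVxi.
  by rewrite (integralD_EFin measurableT iV ixi) xi0 adde0.
split => // x xpos.
have orth : (\int[P]_w (2 * clamp x (V w - c) * xi w)%:E = 0)%E.
  under eq_integral do rewrite xiE.
  apply: (innovation_eq0 (b := 2 * x * K rho j)
    (phi := fun z => 2 * clamp x (V z.1 - c) *
       (f (extend (trajectory z.1) m z.2) - V z.1))).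
  - apply: measurable_funM => //; apply: measurable_funM => //.
    apply: (measurableT_comp (measurable_clamp x)).
    exact: measurable_funB.
  - move=> w y /=; rewrite -[leRHS]mulrA normrM.
    apply: ler_pM => //; last exact: (extend_deviation _ _ (ltW Kj0) flip).
    by rewrite normrM ger0_norm// ler_wpM2l// clamp_norm_le.
  - move=> w /=; under eq_integral do rewrite EFinM.
    rewrite integralZl//.
      by rewrite (average_dev_eq0 _ (ltW Kj0) flip) mule0.
    exact: (integrableB measurableT (integrable_extend _ (ltW Kj0) flip)
      (finite_measure_integrable_cst Q _ measurableT)).
have b0 : 0 <= A2 * K rho j `^ p by rewrite mulr_ge0// powR_ge0.
have step := huber_martingale_step iV ixi mD xiD b0
  (tail_scale Kj0 (tail2 (ltn0Sn m.+1))) p_gt1 p_lt2 xpos orth.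
under eq_integral do rewrite fVxi.
apply: (le_trans step); apply: (le_trans (leeD2r _ (IHb x xpos))).
rewrite -EFinD lee_fin [in leRHS]big_nat_recr//= !addSnnS addnK.
by rewrite -subr_ge0 (_ : _ - _ = 0)//; ring.
Qed.

End chain.

Theorem proposition3p12 (R : realType)
  (XX YY : completeMetricType R)
  (sepX : separable XX) (sepY : separable YY)
  (d : measure_display) (T : measurableType d) (P : probability T R)
  (eps : nat -> {RV P >-> borel YY})
  (eps_indep : mutually_independent [set i | (1 <= i)%N] eps)
  (eps_id : identically_distributed [set i | (1 <= i)%N] eps)
  (X : nat -> {RV P >-> borel XX})
  (X1_indep : independent_of_family (X 1%N) [set i | (2 <= i)%N] eps)
  (F : borel XX * borel YY -> borel XX)
  (F_meas : measurable_fun setT F)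
  (X_chain : forall k, (2 <= k)%N ->
    forall w, X k w = F (X k.-1 w, eps k w))
  (rho C : R) (rho_ge0 : 0 <= rho) (rho_lt1 : rho < 1) (C_gt0 : 0 < C)
  (F_contract : forall x x' : XX,
    ('E_P[fun w => @mdist R XX (F (x, eps 1%N w)) (F (x', eps 1%N w))]
      <= (rho * mdist x x')%:E)%E)
  (F_lip : forall (x : XX) (y y' : YY),
    @mdist R XX (F (x, y)) (F (x, y')) <= C * mdist y y')
  (n : nat) (n_ge1 : (1 <= n)%N)
  (f : n.-tuple XX -> R)
  (f_lip : forall x x' : n.-tuple XX,
    `|f x - f x'| <= \sum_(i < n) mdist (tnth x i) (tnth x' i))
  (p : R) (p_gt1 : 1 < p) (p_lt2 : p < 2)
  (A1 A2 : R)
  (A1_bound :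
    (weak_moment P p (fun w => G_init (X 1%N) (X 1%N w)) <= A1%:E)%E)
  (A2_bound :
    (weak_moment P p (fun w => G_noise C (eps 1%N) (eps 1%N w)) <= A2%:E)%E) :
  let S := centered P (fun w => f [tuple (X i.+1 w : XX) | i < n]) in
  forall x : R, 0 < x ->
    (P [set w | (x < `|S w|)%R] <= (Cp p * B A1 A2 n rho p / x `^ p)%:E)%E.

Proof.
move=> S x x_gt0.
have G1E z : G_init (X 1%N) z =
    (\int[distribution P (X 1%N)]_z' (1 * @mdist R XX z z')%:E)%E.
  by apply: eq_integral => z' _; rewrite mul1r.
(* X 1 w1 and eps 1 w2 are base points at which the mean distances are finite. *)
have [w1] := weak_moment_exists_lty A1_bound p_gt1.
have [w2] := weak_moment_exists_lty A2_bound p_gt1.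
have G0 (y : YY) : (0 <= G_noise C (eps 1%N) y)%E.
  by apply: integral_ge0 => z _; rewrite lee_fin mulr_ge0 ?mdist_ge0// ltW.
have G10 (y : XX) : (0 <= G_init (X 1%N) y)%E.
  by apply: integral_ge0 => z _; rewrite lee_fin mdist_ge0.
rewrite !gee0_abs// G1E => Qy0 Qx0.
have tail1 (t : R) : 0 < t -> (P [set w |
    (t < mean_dist (distribution P (X 1%N)) 1 (X 1%N w))%R] <= (A1 / t `^ p)%:E)%E.
  move=> t0; apply: le_trans (weak_moment_tail A1_bound t0).
  rewrite (_ : [set w | _] = [set w | (t%:E < `|G_init (X 1%N) (X 1%N w)|)%E])//.
  by apply/funext => w /=; rewrite gee0_abs// G1E (mean_distE ler01 Qx0) lte_fin.
have tail2 k : (1 <= k)%N -> forall t : R, 0 < t -> (P [set w |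
    (t < mean_dist (distribution P (eps 1%N)) C (eps k w))%R] <= (A2 / t `^ p)%:E)%E.
  move=> k1 t t0; apply: le_trans (weak_moment_tail A2_bound t0).
  pose D := [set y | (t < mean_dist (distribution P (eps 1%N)) C y)%R].
  have mD : measurable (D : set (borel YY)).
    rewrite -[D]setTI; apply: measurable_fun_ltr => //.
    exact: (measurable_mean_dist sepY (ltW C_gt0) Qy0).
  rewrite -[leLHS]/(distribution P (eps k) D) (@eps_id k 1%N)//.
  rewrite (_ : distribution P (eps 1%N) D =
    P [set w | (t%:E < `|G_noise C (eps 1%N) (eps 1%N w)|)%E])//.
  congr (P _); apply/funext => w /=.
  by rewrite gee0_abs// /G_noise (mean_distE (ltW C_gt0) Qy0) lte_fin.
case: n n_ge1 f f_lip @S => // m _ f f_lip S.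
pose g (s : nat -> XX) := f [tuple s i | i < m.+1].
have glip : lip_last m (K rho 0) g.
  move=> s s'; apply: (le_trans (f_lip _ _)).
  rewrite big_ord_recr/= /K big_nat1 expr0 mul1r.
  by under eq_bigr do rewrite !tnth_mktuple; rewrite !tnth_mktuple.
have [ig bound] := chain_huber_bound sepX sepY eps_indep eps_id X1_indep F_meas
  X_chain rho_ge0 C_gt0 F_contract F_lip Qy0 Qx0 p_gt1 p_lt2
  (weak_moment_ge0 A1_bound) (weak_moment_ge0 A2_bound) tail1 tail2 glip.
have SE : S = fun w => g (trajectory X w) - (\int[P]_w g (trajectory X w))%R.
  by rewrite /S /centered unlock.
have mS : measurable_fun setT S.
  rewrite SE; apply: measurable_funB => //; apply/measurable_EFinP.
  exact: measurable_int ig.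
have := bound x x_gt0.
rewrite -[X in (X <= _)%E](_ : (\int[P]_w (huber x (S w))%:E)%E = _); last first.
  by rewrite SE.
move/(le_trans (huber_markov P mS x_gt0)).
rewrite muleC -lee_pdivlMr ?exprn_gt0// -EFinM => /le_trans; apply.
rewrite lee_fin /B add0n.
rewrite powRB ?(gt_eqF x_gt0) ?implybT// powR_mulrn ?(ltW x_gt0)//.
rewrite -subr_ge0 (_ : _ - _ = 0)//; field.
by rewrite !gt_eqF ?powR_gt0.
Qed.
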